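(* Consider the finite-horizon MDP, the functions $f_\theta$ ($\theta\in\Theta$), the risk $\mathcal R^\pi(s)$, and the values $V_0^{\pi,\theta}(s)$ described in the context, with initial state $s\in\mathcal S_0$. Let $\theta^*$ be an optimal solution of $$\min_{\theta\in\Theta}\ \min_{\pi\in\Pi(\mathcal M)} V_0^{\pi,\theta}(s).$$ Let $\tilde V^{\theta^*}_t$, $0\le t\le T$, be defined by $\tilde V^{\theta^*}_T(s',x)=\min_{a\in\mathcal A_T}\tilde c^{\theta^*}_T(s',x,a)$ and, for $0\le t\le T-1$ and $(s',x)\in\mathcal S_t\times\mathcal X_t$, $$\tilde V^{\theta^*}_t(s',x)=\min_{a\in\mathcal A_t}\Big\{\tilde c^{\theta^*}_t(s',x,a)+\sum_{s''\in\mathcal S_{t+1}}\mathbb P_t(s''|s',a)\,\tilde V^{\theta^*}_{t+1}\big(s'',x+c_t(s',a)\big)\Big\},$$ and let $\pi^{\theta^*}$ be a policy that at stage $t$ in augmented state $(s',x)$ selects an action attaining this minimum. Then $$\min_{\pi\in\Pi(\mathcal M)}\mathcal R^\pi(s)=\tilde V^{\theta^*}_0(s,0)+f_{\theta^*}(0),$$ and $\pi^{\theta^*}$ is an optimal policy for $\min_{\pi\in\Pi(\mathcal M)}\mathcal R^\pi(s)$.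
   Context: MDP: $T$ is a positive integer; for $0\le t\le T$, $\mathcal S_t$ is a finite state space, $\mathcal A_t$ a finite action space, and $c_t:\mathcal S_t\times\mathcal A_t\to[0,1]$ a cost function; for $0\le t\le T-1$, $\mathbb P_t(\cdot|s,a)$ is a probability distribution on $\mathcal S_{t+1}$ for each $(s,a)\in\mathcal S_t\times\mathcal A_t$. $\Pi(\mathcal M)$ is the set of randomized history-dependent policies: $\pi$ maps the history $H_t=(S_0,A_0,\dots,S_t)$ to a probability distribution on $\mathcal A_t$. $\mathbb E^\pi_{\mathbb P}$ is the expectation for the process $A_t\sim\pi(\cdot|H_t)$, $S_{t+1}\sim\mathbb P_t(\cdot|S_t,A_t)$. Risk: $\Theta\subseteq\mathbb R^{d_\Theta}$ is a parameter set and $f_\theta:\mathbb R\to\mathbb R$ for $\theta\in\Theta$. Define $V_0^{\pi,\theta}(s)=\mathbb E^\pi_{\mathbb P}[f_\theta(\sum_{t=0}^T c_t(S_t,A_t))\mid S_0=s]$ and $\mathcal R^\pi(s)=\min_{\theta\in\Theta}V_0^{\pi,\theta}(s)$. Augmentation: $\mathcal X_t=[0,t]$; $\tilde c^\theta_t(s,x,a)=f_\theta(x+c_t(s,a))-f_\theta(x)$ for $(s,x,a)\in\mathcal S_t\times\mathcal X_t\times\mathcal A_t$. The augmented state variable starts at $X_0=0$ and evolves as $X_{t+1}=X_t+c_t(S_t,A_t)$, so it is a function of the history; a policy depending on $(S_t,X_t)$ is thereby an element of $\Pi(\mathcal M)$. *)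

(* Defs.v *)
From HB Require Import structures.
From mathcomp Require Import all_boot all_order all_algebra.
From mathcomp Require Import classical_sets reals.

Set Implicit Arguments.
Unset Strict Implicit.
Unset Printing Implicit Defensive.

Import Order.TTheory GRing.Theory Num.Theory.
Local Open Scope classical_set_scope.
Local Open Scope ring_scope.

Definition is_distr (R : realType) (X : finType) (p : X -> R) : Prop :=
  (forall x, 0 <= p x) /\ \sum_(x : X) p x = 1.

Definition is_min (R : realType) (E : set R) (m : R) : Prop :=
  E m /\ lbound E m.

(* [risk] and [opt_V0] take [inf] over a possibly infinite set; it is the minimum
   whenever there is one (and 0 on sets that are empty or unbounded below). *)
Lemma is_min_inf (R : realType) (E : set R) (m : R) : is_min E m -> inf E = m.
Proof.
move=> [Em lbm]; apply/eqP; rewrite eq_le; apply/andP; split.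
  by apply: ge_inf => //; exists m.
by apply: lb_le_inf => //; exists m.
Qed.

(* The value does not depend on [a0], which only witnesses non-emptiness. *)
Definition fin_min (R : realType) (X : finType) (a0 : X) (F : X -> R) : R :=
  \big[Num.min/F a0]_(a : X) F a.

Lemma fin_minP (R : realType) (X : finType) (a0 : X) (F : X -> R) :
  is_min [set F a | a in [set: X]] (fin_min a0 F).
Proof.
rewrite /fin_min; split=> /=.
  elim/big_ind: _ => [|x y [a _ <-] [b _ <-]|a _]; [by exists a0| |by exists a].
  by rewrite minEle; case: ifP => _; [exists a | exists b].
by move=> _ /= [a _ <-]; apply: bigmin_le_cond.
Qed.

(* Stages are natural numbers; whatever the families contain at stages beyond
   the horizon is unconstrained and never used. *)
Record mdp (R : realType) := MDP {
  horizon : nat;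
  horizon_gt0 : (0 < horizon)%N;
  St : nat -> finType;
  Act : nat -> finType;
  act0 : forall t, Act t;
  cost : forall t, St t -> Act t -> R;
  cost_itv : forall t (s : St t) (a : Act t),
    (t <= horizon)%N -> 0 <= cost s a <= 1;
  trans : forall t, St t -> Act t -> St t.+1 -> R;
  trans_distr : forall t (s : St t) (a : Act t),
    (t < horizon)%N -> is_distr (trans s a)
}.

Section Policies.
Variables (R : realType) (M : mdp R).
Local Notation T := (horizon M).

(* [hist t] is the type of histories (S_0, A_0, ..., A_(t-1), S_t). *)
Fixpoint hist (t : nat) : finType :=
  match t with
  | 0 => St M 0
  | t'.+1 => (hist t' * Act M t' * St M t'.+1)%type
  end.

Definition last_state (t : nat) : hist t -> St M t :=
  match t with
  | 0 => fun h => h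
  | t'.+1 => fun h => h.2
  end.

(* X_t = c_0(S_0, A_0) + ... + c_(t-1)(S_(t-1), A_(t-1)) *)
Fixpoint past_cost (t : nat) : hist t -> R :=
  match t with
  | 0 => fun _ => 0
  | t'.+1 => fun h => past_cost h.1.1 + cost (last_state h.1.1) h.1.2
  end.

Definition policy := forall t, hist t -> Act M t -> R.

Definition policies : set policy :=
  [set pi | forall t (h : hist t), (t <= T)%N -> is_distr (pi t h)].

(* Probability of the history [h] under [pi], given S_0 = s. *)
Fixpoint hist_prob (pi : policy) (s : St M 0) (t : nat) : hist t -> R :=
  match t with
  | 0 => fun h => (h == s)%:R
  | t'.+1 => fun h => hist_prob pi s h.1.1 * pi t' h.1.1 h.1.2
                      * trans (last_state h.1.1) h.1.2 h.2
  end.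

(* A full trajectory (S_0, A_0, ..., S_T, A_T). *)
Definition traj : finType := (hist T * Act M T)%type.

Definition traj_prob (pi : policy) (s : St M 0) (w : traj) : R :=
  hist_prob pi s w.1 * pi T w.1 w.2.

Definition total_cost (w : traj) : R :=
  past_cost w.1 + cost (last_state w.1) w.2.

Definition expectation (pi : policy) (s : St M 0) (Z : traj -> R) : R :=
  \sum_(w : traj) traj_prob pi s w * Z w.

Section Risk.
Variables (d : nat) (Theta : set 'rV[R]_d) (f : 'rV[R]_d -> R -> R).

Definition V0 (pi : policy) (theta : 'rV[R]_d) (s : St M 0) : R :=
  expectation pi s (fun w => f theta (total_cost w)).

Definition risk (pi : policy) (s : St M 0) : R :=
  inf [set V0 pi theta s | theta in Theta].

Definition optimal_policy (s : St M 0) (pi : policy) : Prop :=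
  policies pi /\ forall pi', policies pi' -> risk pi s <= risk pi' s.

Definition opt_V0 (theta : 'rV[R]_d) (s : St M 0) : R :=
  inf [set V0 pi theta s | pi in policies].

Definition optimal_theta (s : St M 0) (theta : 'rV[R]_d) : Prop :=
  Theta theta /\
  forall theta', Theta theta' -> opt_V0 theta s <= opt_V0 theta' s.

Definition aug_cost (theta : 'rV[R]_d) t (s : St M t) (x : R) (a : Act M t) :=
  f theta (x + cost s a) - f theta x.

(* Augmented value at stage [t] when [k] stages remain after it; the recursion
   of the backward induction is stated by [aug_value_last] and
   [aug_value_step]. *)
Fixpoint aug_togo (theta : 'rV[R]_d) (k t : nat) (s : St M t) (x : R) : R :=
  fin_min (act0 M t) (fun a => aug_cost theta s x a +
    match k with
    | 0 => 0
    | k'.+1 => \sum_(s' : St M t.+1)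
                 trans s a s' * aug_togo theta k' s' (x + cost s a)
    end).

Definition aug_value (theta : 'rV[R]_d) t (s : St M t) (x : R) : R :=
  aug_togo theta (T - t) s x.

Definition aug_qvalue (theta : 'rV[R]_d) t (s : St M t) (x : R)
    (a : Act M t) : R :=
  if (t < T)%N then
    aug_cost theta s x a +
    \sum_(s' : St M t.+1) trans s a s' * aug_value theta s' (x + cost s a)
  else aug_cost theta s x a.

Lemma aug_value_last theta (s : St M T) x :
  aug_value theta s x = fin_min (act0 M T) (aug_cost theta s x).
Proof.
rewrite /aug_value subnn /= /fin_min addr0.
by apply: eq_bigr => a _; rewrite addr0.
Qed.

Lemma aug_value_step theta t (s : St M t) x : (t < T)%N ->
  aug_value theta s x = fin_min (act0 M t) (fun a => aug_cost theta s x a +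
    \sum_(s' : St M t.+1) trans s a s' * aug_value theta s' (x + cost s a)).
Proof. by move=> tT; rewrite /aug_value -(subnSK tT). Qed.

Definition aug_policy := forall t, St M t -> R -> Act M t.

(* [pol] attains the minimum at every augmented state (s, x), x in [0, t]. *)
Definition greedy (theta : 'rV[R]_d) (pol : aug_policy) : Prop :=
  forall t (s : St M t) (x : R), (t <= T)%N -> 0 <= x <= t%:R ->
    aug_qvalue theta s x (pol t s x) = aug_value theta s x.

Definition policy_of_aug (pol : aug_policy) : policy :=
  fun t h a => (a == pol t (last_state h) (past_cost h))%:R.

End Risk.
End Policies.

Arguments policies {R} M _.

(* Main.v *)
Require Import Defs.
From HB Require Import structures.
From mathcomp Require Import all_boot all_order all_algebra.
From mathcomp Require Import classical_sets reals.

Set Implicit Arguments.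
Unset Strict Implicit.
Unset Printing Implicit Defensive.

Import Order.TTheory GRing.Theory Num.Theory.
Local Open Scope classical_set_scope.
Local Open Scope ring_scope.

(** For fixed [theta], follow [E^pi [V~_t(S_t, X_t) + f(X_t)]] as [t] grows. One
    stage of the backward recursion shows that it is nondecreasing in [t], and
    constant when [pi] is greedy; it starts at [V~_0(s, 0) + f(0)] and ends
    below [V_0^{pi,theta}(s)]. So [V~_0(s, 0) + f(0)] is a lower bound for all
    policies, attained by the greedy one. Optimality of [theta*] makes the bound
    at [theta*] a lower bound for every [theta], hence for every risk. *)

Section BackwardInduction.
Variables (R : realType) (M : mdp R) (d : nat) (f : 'rV[R]_d -> R -> R).
Local Notation T := (horizon M).
Implicit Types (theta : 'rV[R]_d) (pi : policy M) (s : St M 0).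

(** Merges the last stage with the earlier ones, so that later comparisons need no case split on
    [t = T]. *)
Lemma aug_value_qvalue theta t (s : St M t) x : (t <= T)%N ->
  aug_value f theta s x = fin_min (act0 M t) (aug_qvalue f theta s x).
Proof.
rewrite /aug_qvalue; case: ltnP => [tT _|Tt tT]; first by rewrite aug_value_step.
(* [Tt] unfolds to [T - t == 0]; rewriting this difference avoids substituting [t] in the type of
   [s]. *)
have -> : aug_value f theta s x = aug_togo f theta 0 s x.
  by rewrite /aug_value (eqP Tt).
by rewrite /= /fin_min addr0; apply: eq_bigr => a _; rewrite addr0.
Qed.

Lemma aug_value_le_qvalue theta t (s : St M t) x a : (t <= T)%N ->
  aug_value f theta s x <= aug_qvalue f theta s x a.
Proof.
by move=> tT; rewrite aug_value_qvalue//; apply: (fin_minP _ _).2; exists a.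
Qed.

(** [greedy] speaks only of [x] in [[0, t]]; this puts every reached augmented state in its
    scope. *)
Lemma past_cost_itv t (h : hist M t) : (t <= T)%N ->
  0 <= past_cost h <= t%:R.
Proof.
elim: t h => [|t IH] h tT /=; first by rewrite lexx.
have /andP[x0 xt] := IH h.1.1 (ltnW tT).
have /andP[c0 c1] := cost_itv (last_state h.1.1) h.1.2 (ltnW tT).
by rewrite addr_ge0//= -natr1 lerD.
Qed.

Lemma hist_prob_ge0 pi s t (h : hist M t) : policies M pi -> (t <= T)%N ->
  0 <= hist_prob pi s h.
Proof.
move=> piP; elim: t h => [|t IH] h tT /=; first by rewrite ler0n.
rewrite !mulr_ge0 ?IH 1?ltnW//.
- exact: (piP _ _ (ltnW tT)).1.
- exact: (trans_distr _ _ tT).1.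
Qed.

Definition hist_value theta t (h : hist M t) : R :=
  aug_value f theta (last_state h) (past_cost h) + f theta (past_cost h).

Definition hist_qvalue theta t (h : hist M t) (a : Act M t) : R :=
  aug_qvalue f theta (last_state h) (past_cost h) a + f theta (past_cost h).

(** The new past cost does not depend on [s'], so its [f theta] term leaves the sum with weight 1;
    the [f theta] of the old past cost cancels the one subtracted in [aug_cost]. *)
Lemma hist_qvalue_step theta t (h : hist M t) a : (t < T)%N ->
  \sum_(s' : St M t.+1)
     trans (last_state h) a s' * hist_value theta ((h, a, s') : hist M t.+1)
  = hist_qvalue theta h a.
Proof.
move=> tT; rewrite /hist_qvalue /aug_qvalue tT /aug_cost /hist_value /=.
under eq_bigr do rewrite mulrDr.
rewrite big_split /= -mulr_suml (trans_distr _ _ tT).2 mul1r.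
by rewrite addrC [RHS]addrAC subrK.
Qed.

Lemma hist_qvalue_last theta (h : hist M T) a :
  hist_qvalue theta h a = f theta (total_cost (h, a)).
Proof. by rewrite /hist_qvalue /aug_qvalue ltnn /aug_cost subrK. Qed.

Definition stage_value theta pi s t : R :=
  \sum_(h : hist M t) hist_prob pi s h * hist_value theta h.

(** Half a stage later: [A_t] is drawn from [pi], and minimization resumes only at [t.+1]. At
    [t = T] nothing is left to minimize. *)
Definition stage_qvalue theta pi s t : R :=
  \sum_(h : hist M t)
     hist_prob pi s h * \sum_(a : Act M t) pi t h a * hist_qvalue theta h a.

Lemma stage_value0 theta pi s :
  stage_value theta pi s 0 = aug_value f theta s 0 + f theta 0.
Proof.
rewrite /stage_value (bigD1 s)//= eqxx mul1r big1 ?addr0// => h /negPf ->.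
by rewrite mul0r.
Qed.

Lemma stage_valueS theta pi s t : (t < T)%N ->
  stage_value theta pi s t.+1 = stage_qvalue theta pi s t.
Proof.
move=> tT; rewrite /stage_value /stage_qvalue.
(* Writing the summand with projections lets [pair_bigA] split the sum over histories into sums over
   [h], [a] and [s']. *)
rewrite (eq_bigr (fun w : hist M t * Act M t * St M t.+1 =>
    hist_prob pi s w.1.1 * pi t w.1.1 w.1.2
    * (trans (last_state w.1.1) w.1.2 w.2
       * hist_value theta ((w.1.1, w.1.2, w.2) : hist M t.+1)))); last first.
  by case=> [[h a] s'] _ /=; rewrite !mulrA.
rewrite -(pair_bigA _ (fun (w : hist M t * Act M t) (s' : St M t.+1) =>
    hist_prob pi s w.1 * pi t w.1 w.2
    * (trans (last_state w.1) w.2 s'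
       * hist_value theta ((w.1, w.2, s') : hist M t.+1)))) /=.
rewrite -(pair_bigA _ (fun (h : hist M t) (a : Act M t) =>
    \sum_(s' : St M t.+1) hist_prob pi s h * pi t h a * (trans (last_state h) a s'
       * hist_value theta ((h, a, s') : hist M t.+1)))) /=.
apply: eq_bigr => h _; rewrite mulr_sumr; apply: eq_bigr => a _.
by rewrite -mulr_sumr hist_qvalue_step// mulrA.
Qed.

Lemma stage_qvalue_last theta pi s :
  stage_qvalue theta pi s T = V0 f pi theta s.
Proof.
rewrite /stage_qvalue /V0 /expectation /traj_prob.
rewrite -(pair_bigA _ (fun h a => hist_prob pi s h * pi T h a
                         * f theta (total_cost (h, a)))) /=.
apply: eq_bigr => h _; rewrite mulr_sumr; apply: eq_bigr => a _.
by rewrite hist_qvalue_last mulrA.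
Qed.

(** At each history, a minimum over actions is at most the average under [pi t h]. *)
Lemma stage_value_le theta pi s t : policies M pi -> (t <= T)%N ->
  stage_value theta pi s t <= stage_qvalue theta pi s t.
Proof.
move=> piP tT; apply: ler_sum => h _.
apply: ler_wpM2l; first exact: hist_prob_ge0.
have [pi0 pi1] := piP _ h tT.
rewrite -[leLHS]mul1r -pi1 mulr_suml; apply: ler_sum => a _.
by apply: ler_wpM2l => //; rewrite lerD2r aug_value_le_qvalue.
Qed.

Lemma V0_ge theta pi s : policies M pi ->
  aug_value f theta s 0 + f theta 0 <= V0 f pi theta s.
Proof.
move=> piP; rewrite -(stage_value0 theta pi) -stage_qvalue_last.
suff H t : (t <= T)%N -> stage_value theta pi s 0 <= stage_value theta pi s t.
  exact: le_trans (H _ (leqnn T)) (stage_value_le _ _ piP (leqnn T)).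
elim: t => // t IH tT; apply: le_trans (IH (ltnW tT)) _.
by rewrite stage_valueS// stage_value_le// ltnW.
Qed.

Lemma sum_policy_of_aug (pol : aug_policy M) t (h : hist M t)
    (F : Act M t -> R) :
  \sum_(a : Act M t) policy_of_aug pol h a * F a
  = F (pol t (last_state h) (past_cost h)).
Proof.
rewrite (bigD1 (pol t (last_state h) (past_cost h)))//= /policy_of_aug.
by rewrite eqxx mul1r big1 ?addr0// => a /negPf ->; rewrite mul0r.
Qed.

Lemma policy_of_augP (pol : aug_policy M) : policies M (policy_of_aug pol).
Proof.
move=> t h tT; split=> [a|]; first exact: ler0n.
(* The constant function 1 gives the total mass of the Dirac policy. *)
have := sum_policy_of_aug pol h (fun=> 1).
by under eq_bigr do rewrite mulr1.
Qed.

Lemma stage_value_greedy theta (pol : aug_policy M) s t :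
  greedy f theta pol -> (t <= T)%N ->
  stage_value theta (policy_of_aug pol) s t
  = stage_qvalue theta (policy_of_aug pol) s t.
Proof.
move=> polG tT; apply: eq_bigr => h _; congr (_ * _).
by rewrite sum_policy_of_aug /hist_qvalue polG// past_cost_itv.
Qed.

Lemma V0_greedy theta (pol : aug_policy M) s : greedy f theta pol ->
  V0 f (policy_of_aug pol) theta s = aug_value f theta s 0 + f theta 0.
Proof.
move=> polG; rewrite -(stage_value0 theta (policy_of_aug pol)).
rewrite -stage_qvalue_last -stage_value_greedy//.
have: (T <= T)%N by [].
(* Generalizes the stage but keeps the bound [T]: the value is constant over all [t <= T]. *)
elim: {1 3}T => // t IH tT.
by rewrite stage_valueS// -stage_value_greedy ?IH// ltnW.
Qed.

Lemma opt_V0_le theta pi s : policies M pi ->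
  opt_V0 f theta s <= V0 f pi theta s.
Proof.
move=> piP; apply: ge_inf; last by exists pi.
(* [ge_inf] needs a set bounded below; [V0_ge] supplies the bound. *)
by exists (aug_value f theta s 0 + f theta 0) => _ [pi' pi'P <-]; exact: V0_ge.
Qed.

Lemma opt_V0_greedy theta (pol : aug_policy M) s : greedy f theta pol ->
  opt_V0 f theta s = aug_value f theta s 0 + f theta 0.
Proof.
move=> polG; apply: is_min_inf; split.
  by exists (policy_of_aug pol); [exact: policy_of_augP | exact: V0_greedy].
by move=> _ [pi piP <-]; exact: V0_ge.
Qed.

End BackwardInduction.

Theorem theorem2p1 (R : realType) (M : mdp R) (d : nat)
    (Theta : set 'rV[R]_d) (f : 'rV[R]_d -> R -> R) (s : St M 0)
    (theta_star : 'rV[R]_d)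
    (theta_star_opt : optimal_theta Theta f s theta_star)
    (pi_star : aug_policy M)
    (pi_star_greedy : greedy f theta_star pi_star) :
  is_min [set risk Theta f pi s | pi in policies M]
         (aug_value f theta_star s 0 + f theta_star 0)
  /\ optimal_policy Theta f s (policy_of_aug pi_star).
Proof.
set m := aug_value f theta_star s 0 + f theta_star 0.
have [Theta_star theta_star_min] := theta_star_opt.
have V0_ge_m pi theta : policies M pi -> Theta theta -> m <= V0 f pi theta s.
  (* The chain is [m = opt_V0 theta_star <= opt_V0 theta <= V0 pi theta]; the greedy policy gives
     the equality, at [theta_star] only. *)
  move=> piP thetaP; rewrite /m -(opt_V0_greedy s pi_star_greedy).
  exact: le_trans (theta_star_min _ thetaP) (opt_V0_le f theta s piP).
have risk_ge_m pi : policies M pi -> m <= risk Theta f pi s.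
  (* [theta_star] shows the set nonempty, which excludes the default value 0 of [inf] on the empty
     set. *)
  move=> piP; apply: lb_le_inf; first by exists (V0 f pi theta_star s), theta_star.
  by move=> _ [theta thetaP <-]; exact: V0_ge_m.
have pi_starP := policy_of_augP pi_star.
have risk_star : risk Theta f (policy_of_aug pi_star) s = m.
  apply: is_min_inf; split.
    by exists theta_star => //; exact: V0_greedy.
  by move=> _ [theta thetaP <-]; exact: V0_ge_m.
split.
  split; first by exists (policy_of_aug pi_star).
  by move=> _ [pi piP <-]; exact: risk_ge_m.
by split=> // pi piP; rewrite risk_star; exact: risk_ge_m.
Qed.
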